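(* A countable directed forest is unary FA-presentable if and only if (1) it has only finitely many infinite connected components, each of which is a unary FA-presentable directed tree, and (2) there is a bound on the number of vertices of its finite connected components.
   Context: A directed forest is a directed graph obtained from a forest (an acyclic undirected graph) by assigning a direction to each edge; its connected components (components of the underlying undirected graph) are directed trees. A structure $(X,\eta)$ is unary FA-presentable if there exist a regular language $L\subseteq a^*$ and a surjection $\phi:L\to X$ such that $\{(u,v)\in L^2:u\phi=v\phi\}$ and $\{(u,v)\in L^2:(u\phi,v\phi)\in\eta\}$ are regular relations (the words $\mathrm{conv}(u,v)$ over $\{a,\$\}^2$, reading $u,v$ in parallel with the shorter padded by $\$$, form regular languages). *)

(* Defs.v *)
From mathcomp Require Import all_boot.
From Stdlib Require List.
Set Implicit Arguments. Unset Strict Implicit. Unset Printing Implicit Defensive.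

Record dfa (S : finType) := DFA {
  dstate : finType;
  dstart : dstate;
  dfinal : pred dstate;
  dtrans : dstate -> S -> dstate }.

Definition accepts (S : finType) (A : dfa S) (w : seq S) : bool :=
  @dfinal S A (foldl (@dtrans S A) (@dstart S A) w).

Definition regular (S : finType) (L : seq S -> Prop) : Prop :=
  exists A : dfa S, forall w, L w <-> accepts A w.

(** Unary words a^n are represented by their length n : nat.
    A language L ⊆ a^* is encoded as a predicate on nat; the alphabet {a} is [unit]. *)
Definition unary_regular (L : nat -> Prop) : Prop :=
  regular (fun w : seq unit => L (size w)).

(** conv(a^m, a^n) over {a,$}^2: letter i is (i < m, i < n), where
    [true] stands for [a] and [false] for the padding symbol [$]. *)
Definition conv (m n : nat) : seq (bool * bool) :=
  mkseq (fun i => (i < m, i < n)) (maxn m n).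

Definition regular_rel (R : nat -> nat -> Prop) : Prop :=
  regular (fun w : seq (bool * bool) => exists m n, w = conv m n /\ R m n).

Definition unary_FA_presentable (X : Type) (eta : X -> X -> Prop) : Prop :=
  exists (L : nat -> Prop) (phi : {n : nat | L n} -> X),
    unary_regular L /\
    (forall x : X, exists u : {n : nat | L n}, phi u = x) /\
    regular_rel (fun m n => exists (hm : L m) (hn : L n),
                   phi (exist _ m hm) = phi (exist _ n hn)) /\
    regular_rel (fun m n => exists (hm : L m) (hn : L n),
                   eta (phi (exist _ m hm)) (phi (exist _ n hn))).

Definition countable_type (X : Type) : Prop :=
  exists f : X -> nat, injective f.

Definition und (X : Type) (eta : X -> X -> Prop) (x y : X) : Prop :=
  eta x y \/ eta y x.

Fixpoint epath (X : Type) (E : X -> X -> Prop) (x : X) (l : seq X) : Prop :=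
  if l is y :: l' then E x y /\ epath E y l' else True.

Definition acyclic (X : Type) (E : X -> X -> Prop) : Prop :=
  forall (x : X) (l : seq X),
    List.NoDup (x :: l) -> 2 <= size l -> epath E x l -> ~ E (last x l) x.

Definition directed_forest (X : Type) (eta : X -> X -> Prop) : Prop :=
  (forall x, ~ eta x x) /\
  (forall x y, eta x y -> ~ eta y x) /\
  acyclic (und eta).

Inductive connected (X : Type) (eta : X -> X -> Prop) (x : X) : X -> Prop :=
  | conn_refl : connected eta x x
  | conn_step y z : connected eta x y -> und eta y z -> connected eta x z.

Definition component (X : Type) (eta : X -> X -> Prop) (x : X) : Type :=
  {y : X | connected eta x y}.

Definition component_rel (X : Type) (eta : X -> X -> Prop) (x : X)
  (u v : component eta x) : Prop := eta (proj1_sig u) (proj1_sig v).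

Definition finite_pred (X : Type) (P : X -> Prop) : Prop :=
  exists s : seq X, forall y, P y -> List.In y s.

Definition infinite_component (X : Type) (eta : X -> X -> Prop) (x : X) : Prop :=
  ~ finite_pred (connected eta x).

Definition finitely_many_infinite_components (X : Type) (eta : X -> X -> Prop) : Prop :=
  exists reps : seq X, forall x, infinite_component eta x ->
    exists2 r, List.In r reps & connected eta r x.

Definition finite_components_bounded (X : Type) (eta : X -> X -> Prop) : Prop :=
  exists N : nat, forall x, finite_pred (connected eta x) ->
    exists s : seq X, size s <= N /\ forall y, connected eta x y -> List.In y s.

(* Main.v *)
Require Import Defs.
From mathcomp Require Import all_boot.
From mathcomp Require Import zify boolp.
From Stdlib Require List.

(** A relation on a^* is regular iff it is eventually periodic: invariant under shifting
    both arguments by [p], and under shifting the larger one by [p] once the arguments are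
    far apart. Choosing least representatives, a presentation becomes an injective coding
    of the vertices by natural numbers.

    In a forest, an edge between two large and far apart codes would, by periodicity, give
    a 4-cycle. So for a suitable [q] the edges between codes [>= q] have length [< q] and
    are invariant under the shift by [q]. A component avoiding the codes [< q] that contains
    two codes congruent modulo [q] contains a whole arithmetic progression, hence is infinite;
    so the finite components avoiding [0, q) have at most [q] vertices. An infinite component
    avoiding [0, q) meets every late enough window of length [q], so there are at most [q] of
    them. Every component is a finite union of eventually periodic sets, so its restriction
    of the coding is again a presentation.

    Conversely, finite components of bounded size fall into finitely many isomorphism types;
    the copies of one type are coded by (number of the copy, position in the copy), and
    finitely many presentations are combined by interleaving. *)

Set Implicit Arguments. Unset Strict Implicit. Unset Printing Implicit Defensive.

(** * Regular relations on unary words *)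

Definition periodic_from (N p : nat) (S : nat -> Prop) : Prop :=
  forall n, N <= n -> (S n <-> S (n + p)).

(** In [conv m n], shifting both arguments lengthens the common block of letters, and shifting only
    the larger one lengthens the padded tail; each clause pumps one of these blocks. *)
Definition rel_periodic_from (N p : nat) (R : nat -> nat -> Prop) : Prop :=
  [/\ forall m n, N <= m -> N <= n -> (R m n <-> R (m + p) (n + p)),
      forall m n, m + N <= n -> (R m n <-> R m (n + p)) &
      forall m n, n + N <= m -> (R m n <-> R (m + p) n)].

Lemma periodic_fromM N p S n k :
  periodic_from N p S -> N <= n -> (S n <-> S (n + k * p)).
Proof.
move=> HS Nn; elim: k => [|k IHk]; first by rewrite mul0n addn0.
rewrite IHk HS; last by lia.
by rewrite mulSn -addnA (addnC p).
Qed.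

Lemma periodic_from_weaken N p N' p' S :
  N <= N' -> p %| p' -> periodic_from N p S -> periodic_from N' p' S.
Proof.
by move=> NN' /dvdnP[k ->] HS n N'n; apply: periodic_fromM HS _; apply: leq_trans N'n.
Qed.

Lemma rel_periodic_from_diag N p R : rel_periodic_from N p R ->
  forall d, periodic_from N p (fun m => R m (m + d)) /\
            periodic_from N p (fun m => R (m + d) m).
Proof.
move=> [Ra _ _] d; split=> m Nm.
  by rewrite (Ra m) ?(addnAC m p) //; lia.
by rewrite (Ra (m + d)) ?(addnAC m p) //; lia.
Qed.

Lemma rel_periodic_from_off N p R : rel_periodic_from N p R ->
  forall m, periodic_from N p (fun d => R m (m + d)) /\
            periodic_from N p (fun d => R (m + d) m).
Proof.
move=> [_ Rb Rc] m; split=> d Nd; rewrite addnA.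
  by apply: Rb; lia.
by apply: Rc; lia.
Qed.

(** Converse of the two preceding lemmas. With the larger argument written as the smaller plus a
    gap, it suffices to have one-variable periodicity along diagonals and in the gap. *)
Lemma rel_periodic_fromP N p R :
  (forall d, periodic_from N p (fun m => R m (m + d)) /\
             periodic_from N p (fun m => R (m + d) m)) ->
  (forall m, periodic_from N p (fun d => R m (m + d)) /\
             periodic_from N p (fun d => R (m + d) m)) ->
  rel_periodic_from N p R.
Proof.
move=> Hd Ho; split=> m n.
- move=> Nm Nn; case: (leqP m n) => mn.
    have [H _] := Hd (n - m); have := H m Nm.
    by rewrite addnAC subnKC.
  have [_ H] := Hd (m - n); have := H n Nn.
  by rewrite addnAC subnKC // ltnW.
- move=> H; have [H1 _] := Ho m; have := H1 (n - m).
  by rewrite addnA subnKC; [apply; lia | lia].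
- move=> H; have [_ H1] := Ho n; have := H1 (m - n).
  by rewrite addnA subnKC; [apply; lia | lia].
Qed.

Lemma rel_periodic_from_weaken N p N' p' R :
  N <= N' -> p %| p' -> rel_periodic_from N p R -> rel_periodic_from N' p' R.
Proof.
move=> NN' pp' HR; apply: rel_periodic_fromP => k.
  have [? ?] := rel_periodic_from_diag HR k.
  by split; apply: periodic_from_weaken; eassumption.
have [? ?] := rel_periodic_from_off HR k.
by split; apply: periodic_from_weaken; eassumption.
Qed.

Lemma rel_periodic_from_restrict N p S R :
  periodic_from N p S -> rel_periodic_from N p R ->
  rel_periodic_from N p (fun m n => S m /\ S n /\ R m n).
Proof.
move=> HS [Ra Rb Rc]; split=> m n.
- by move=> Nm Nn; have := HS m Nm; have := HS n Nn; have := Ra m n Nm Nn; tauto.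
- move=> mn; have Nn : N <= n by lia.
  by have := HS n Nn; have := Rb m n mn; tauto.
- move=> nm; have Nm : N <= m by lia.
  by have := HS m Nm; have := Rc m n nm; tauto.
Qed.

(** Two of the first [#|Q|.+1] iterates coincide by pigeonhole, so the orbit has a period at most
    [#|Q|]. The factorial is a multiple of every such period, hence uniform in [f] and [x]. *)
Lemma iter_periodic (Q : finType) (f : Q -> Q) (x : Q) (n : nat) :
  #|Q| <= n -> iter (n + #|Q|`!) f x = iter n f x.
Proof.
move=> Qn.
have [i [j [ij jQ fij]]] : exists i j, [/\ i < j, j <= #|Q| & iter i f x = iter j f x].
  have : ~~ uniq (traject f x #|Q|.+1).
    apply/negP => /card_uniqP H; have := max_card [in traject f x #|Q|.+1].
    by rewrite H size_traject ltnn.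
  case/(uniqPn x) => i [j] []; rewrite size_traject => ij jQ.
  rewrite !nth_traject //; last by lia.
  by exists i, j.
have step k m : i <= m -> iter (m + k * (j - i)) f x = iter m f x.
  move=> im; elim: k => [|k IHk]; first by rewrite mul0n addn0.
  have -> : m + k.+1 * (j - i) = (m - i + k * (j - i)) + j by lia.
  by rewrite iterD -fij -iterD -IHk; congr iter; lia.
have /dvdnP[k ->] : j - i %| #|Q|`! by apply: dvdn_fact; lia.
by apply: step; lia.
Qed.

Lemma conv_cat (m d : nat) :
  conv m (m + d) = nseq m (true, true) ++ nseq d (false, true) /\
  conv (m + d) m = nseq m (true, true) ++ nseq d (true, false).
Proof.
have mx : maxn m (m + d) = m + d by lia.
have mx' : maxn (m + d) m = m + d by lia.
split; apply: (@eq_from_nth _ (true, true)).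
- by rewrite size_mkseq size_cat !size_nseq mx.
- move=> i; rewrite size_mkseq mx => i_lt; rewrite nth_mkseq ?mx // nth_cat size_nseq !nth_nseq.
  by rewrite i_lt; case: (ltnP i m) => h //; case: ltnP => //; lia.
- by rewrite size_mkseq size_cat !size_nseq mx'.
- move=> i; rewrite size_mkseq mx' => i_lt; rewrite nth_mkseq ?mx' // nth_cat size_nseq !nth_nseq.
  by rewrite i_lt; case: (ltnP i m) => h //; case: ltnP => //; lia.
Qed.

(** Counting the entries [true] in either track recovers the corresponding argument. *)
Lemma conv_inj m n m' n' : conv m n = conv m' n' -> m = m' /\ n = n'.
Proof.
have cnt1 a b : count (fun l => l.1) (conv a b) = a.
  case: (leqP a b) => [/subnKC|/ltnW/subnKC] <-.
    rewrite (conv_cat _ _).1 count_cat !count_nseq /=; lia.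
  rewrite (conv_cat _ _).2 count_cat !count_nseq /=; lia.
have cnt2 a b : count (fun l => l.2) (conv a b) = b.
  case: (leqP a b) => [/subnKC|/ltnW/subnKC] <-.
    rewrite (conv_cat _ _).1 count_cat !count_nseq /=; lia.
  rewrite (conv_cat _ _).2 count_cat !count_nseq /=; lia.
by move=> e; split; [rewrite -(cnt1 m n) e cnt1 | rewrite -(cnt2 m n) e cnt2].
Qed.

Lemma foldl_nseq (T S : Type) (f : T -> S -> T) x a n :
  foldl f x (nseq n a) = iter n (f^~ a) x.
Proof. by elim: n x => [//|n IHn] x; rewrite /= IHn -iterSr. Qed.

(** On a convolution the automaton iterates one transition map and then another, so both blocks can
    be pumped by the same factorial. *)
Lemma regular_rel_periodic R : regular_rel R ->
  exists N p, 0 < p /\ rel_periodic_from N p R.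
Proof.
case=> A HA; have RA m n : R m n <-> accepts A (conv m n).
  rewrite -HA; split=> [Rmn|[m' [n' [/conv_inj[-> ->]]]]] //.
  by exists m, n.
exists #|dstate A|, (#|dstate A|`!); split; first exact: fact_gt0.
apply: rel_periodic_fromP => k; split=> m Nm;
  rewrite !RA /accepts ?(conv_cat _ _).1 ?(conv_cat _ _).2 !foldl_cat !foldl_nseq;
  by rewrite iter_periodic.
Qed.

(** * From periodicity to automata *)

(** One half of a Myhill-Nerode argument: a machine with infinitely many states may be replaced by
    the finite set of values of an invariant [rho] that its steps and its acceptance respect. *)
Lemma regular_congruence (S : finType) (T : Type) (F : finType) (step : T -> S -> T)
    (t0 : T) (P : T -> Prop) (rho : T -> F) :
  (forall t t' s, rho t = rho t' -> rho (step t s) = rho (step t' s)) ->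
  (forall t t', rho t = rho t' -> (P t <-> P t')) ->
  regular (fun w => P (foldl step t0 w)).
Proof.
move=> Hstep HP.
have /choice[sec Hsec] : forall q : F, exists t, (exists t', rho t' = q) -> rho t = q.
  move=> q; case: (pselect (exists t', rho t' = q)) => [[t ?]|n]; first by exists t.
  (* Values that [rho] never takes get an arbitrary representative; no run reaches them. *)
  by exists t0.
have secK t : rho (sec (rho t)) = rho t by apply: Hsec; exists t.
pose A := @DFA S F (rho t0) (fun q => `[< P (sec q) >]) (fun q s => rho (step (sec q) s)).
exists A => w.
have run : foldl (@dtrans S A) (@dstart S A) w = rho (foldl step t0 w).
  rewrite /=; move: (t0); elim: w => [//|s w IHw] t /=.
  by rewrite -IHw; congr (foldl _ _ w); apply: Hstep.
rewrite /accepts run /=; rewrite (HP _ _ (esym (secK _))).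
by split=> /asboolP.
Qed.

(** The position of [n] on a lasso with a tail of length [N] and a cycle of length [p]. *)
Definition fold_period (N p n : nat) : nat := if n < N then n else N + (n - N) %% p.

Lemma fold_period_lt N p n : 0 < p -> fold_period N p n < N + p.
Proof.
move=> p0; rewrite /fold_period; case: (ltnP n N) => h; first by lia.
by rewrite ltn_add2l ltn_pmod.
Qed.

Lemma fold_periodS N p n m :
  fold_period N p n = fold_period N p m -> fold_period N p n.+1 = fold_period N p m.+1.
Proof.
rewrite /fold_period; case: (ltnP n N) => hn; case: (ltnP m N) => hm.
- by move=> ->.
- by move: (_ %% _) => ?; lia.
- by move: (_ %% _) => ?; lia.
move/addnI => e; rewrite !ifF ?(subSn hn) ?(subSn hm); try lia.
by congr (_ + _); rewrite -addn1 -modnDml e modnDml addn1.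
Qed.

(** A nonempty tail keeps 0 alone in its class, so that a folded truncated difference still decides
    an inequality. *)
Lemma fold_period0 N p n : 0 < N -> fold_period N p n = fold_period N p 0 -> n = 0.
Proof.
by rewrite /fold_period => N0; rewrite N0; case: ltnP => // ?; move: (_ %% _) => ?; lia.
Qed.

Lemma fold_periodP N p S n m : periodic_from N p S ->
  fold_period N p n = fold_period N p m -> (S n <-> S m).
Proof.
move=> HS; rewrite /fold_period; case: (ltnP n N) => hn; case: (ltnP m N) => hm.
- by move=> ->.
- by move: (_ %% _) => ?; lia.
- by move: (_ %% _) => ?; lia.
move/addnI => e.
wlog: n m hn hm e / n <= m.
  move=> W; case: (leqP n m) => [|/ltnW] nm; first exact: W.
  by rewrite (W m n).
move=> nm; have /dvdnP[k kE] : p %| m - n.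
  by have : m - N == n - N %[mod p]; [rewrite e | rewrite eqn_mod_dvd ?leq_sub2r //; congr (_ %| _); lia].
have -> : m = n + k * p by lia.
exact: periodic_fromM HS hn.
Qed.

Lemma periodic_unary_regular N p S : 0 < p -> periodic_from N p S -> unary_regular S.
Proof.
move=> p0 HS.
(* The bound is written as a successor because [inord] requires that shape. *)
pose rho n : 'I_(N + p).-1.+1 := inord (fold_period N p n).
have rhoP n m : rho n = rho m -> fold_period N p n = fold_period N p m.
  move/(congr1 val); rewrite /= !inordK //.
    by have := fold_period_lt N m p0; lia.
  by have := fold_period_lt N n p0; lia.
rewrite /unary_regular.
have -> : (fun w : seq unit => S (size w)) =
          (fun w => S (foldl (fun n _ => n.+1) 0 w)).
  apply/funext => w; congr S; rewrite -[size w]addn0; move: 0.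
  by elim: w => [//|u w IHw] n /=; rewrite -IHw addSnnS.
apply: (@regular_congruence _ _ _ _ _ _ rho) => [n m _ /rhoP e|n m /rhoP].
  by rewrite /rho (fold_periodS e).
exact: fold_periodP.
Qed.

(** The state holds the two lengths read so far. A track may receive a letter only while it is not
    the shorter one, since padding never precedes a letter; any other input leads to the sink
    [None]. *)
Definition conv_step (s : option (nat * nat)) (l : bool * bool) : option (nat * nat) :=
  if s is Some (m, n) then
    if [&& l.1 || l.2, l.1 ==> (n <= m) & l.2 ==> (m <= n)]
    then Some (m + l.1, n + l.2) else None
  else None.

Lemma conv_stepP w m n :
  foldl conv_step (Some (0, 0)) w = Some (m, n) <-> w = conv m n.
Proof.
have iter1 a k : iter k (conv_step^~ (true, true)) (Some (a, a)) = Some (a + k, a + k).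
  by elim: k => [|k /= ->]; rewrite ?addn0 //= leqnn /= !addn1 !addnS.
have iter2 a k : iter k (conv_step^~ (false, true)) (Some (a, a)) = Some (a, a + k).
  by elim: k => [|k /= ->]; rewrite ?addn0 //= leq_addr /= !addn1 !addn0 !addnS.
have iter3 a k : iter k (conv_step^~ (true, false)) (Some (a, a)) = Some (a + k, a).
  by elim: k => [|k /= ->]; rewrite ?addn0 //= leq_addr /= !addn1 !addn0 !addnS.
split=> [|->]; last first.
  case: (leqP m n) => [/subnKC|/ltnW/subnKC] <-.
    by rewrite (conv_cat _ _).1 foldl_cat !foldl_nseq iter1 iter2.
  by rewrite (conv_cat _ _).2 foldl_cat !foldl_nseq iter1 iter3.
elim/last_ind: w m n => [|w l IHw] m n; first by case=> <- <-.
rewrite foldl_rcons; case E: (foldl _ _ w) => [[a b]|] //=.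
case: ifP => // /and3P[l12 l1 l2] [<- <-]; rewrite (IHw _ _ E).
case: l l12 l1 l2 => [[] []] //= _ l1 l2; rewrite ?addn0 -cats1.
- have <- : a = b by lia.
  have [] := conv_cat a 0; have [] := conv_cat (a + 1) 0.
  by rewrite !addn0 !cats0 => -> _ -> _; rewrite nseqD.
- by rewrite -(subnKC l1) -addnA !(conv_cat _ _).2 nseqD catA.
- by rewrite -(subnKC l2) -addnA !(conv_cat _ _).1 nseqD catA.
Qed.

(** The finite invariant of a state [(m, n)] consists of the folded minimum and the two folded
    truncated differences. A zero difference reveals the order of the arguments, and [R] is periodic
    in the minimum and in the gap. *)
Lemma periodic_regular_rel N p R : 0 < p -> rel_periodic_from N p R -> regular_rel R.
Proof.
(* Raising the threshold to [N.+1] makes the tail nonempty, so that the difference 0 is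
   recognised. *)
move=> p0 /(rel_periodic_from_weaken (leqnSn N) (dvdnn p)) HR.
pose F := fold_period N.+1 p; pose O := 'I_(N + p).+1.
pose rho (s : option (nat * nat)) : option (O * O * O) :=
  if s is Some (m, n) then Some (inord (F (minn m n)), inord (F (m - n)), inord (F (n - m)))
  else None.
have inj i j : inord (F i) = inord (F j) :> O -> F i = F j.
  by move/(congr1 val); rewrite /= !inordK // /F -addSn; apply: fold_period_lt.
have rhoP m n m' n' : rho (Some (m, n)) = rho (Some (m', n')) ->
    [/\ F (minn m n) = F (minn m' n'), F (m - n) = F (m' - n') & F (n - m) = F (n' - m')].
  by case=> /inj ? /inj ? /inj ?.
have le_eq m n m' n' : F (m - n) = F (m' - n') -> (m <= n) = (m' <= n').
  move=> e; rewrite -!subn_eq0; apply/eqP/eqP => e0; move: e; rewrite e0.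
    by move/esym/fold_period0; apply.
  by move/fold_period0; apply.
have [le_mn lt_nm] : (forall m n, m <= n -> minn m n = m) /\ (forall m n, n <= m -> minn m n = n).
  by split=> m n; lia.
pose P s := if s is Some (m, n) then R m n else False.
rewrite /regular_rel.
have -> : (fun w => exists m n, w = conv m n /\ R m n) =
          (fun w => P (foldl conv_step (Some (0, 0)) w)).
  apply/funext => w; apply/propext; split=> [[m [n [/conv_stepP -> //]]]|].
  case E: (foldl _ _ _) => [[m n]|] //= Rmn; exists m, n; split=> //.
  exact/conv_stepP.
apply: (@regular_congruence _ _ _ _ _ _ rho).
- move=> [[m n]|] [[m' n']|] // l /rhoP[e1 e2 e3] /=.
  rewrite (le_eq _ _ _ _ e2) (le_eq _ _ _ _ e3).
  have := le_eq _ _ _ _ e2; have := le_eq _ _ _ _ e3.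
  case: ifP => // /and3P[l12 l1 l2] le1 le2 /=.
  suff [-> -> ->] : [/\ F (minn (m + l.1) (n + l.2)) = F (minn (m' + l.1) (n' + l.2)),
     F ((m + l.1) - (n + l.2)) = F ((m' + l.1) - (n' + l.2)) &
     F ((n + l.2) - (m + l.1)) = F ((n' + l.2) - (m' + l.1))] by [].
  case: l l12 l1 l2 => [[] []] //= _ l1 l2.
  + have mn : minn (m + 1) (n + 1) = (minn m n).+1 by lia.
    have mn' : minn (m' + 1) (n' + 1) = (minn m' n').+1 by lia.
    by rewrite mn mn' !subnDr; split=> //; apply: fold_periodS.
  + rewrite !addn0.
    have -> : minn (m + 1) n = minn m n by lia.
    have -> : minn (m' + 1) n' = minn m' n' by lia.
    have -> : m + 1 - n = (m - n).+1 by lia.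
    have -> : m' + 1 - n' = (m' - n').+1 by lia.
    have -> : n - (m + 1) = 0 by lia.
    have -> : n' - (m' + 1) = 0 by lia.
    by split=> //; apply: fold_periodS.
  + rewrite !addn0.
    have -> : minn m (n + 1) = minn m n by lia.
    have -> : minn m' (n' + 1) = minn m' n' by lia.
    have -> : n + 1 - m = (n - m).+1 by lia.
    have -> : n' + 1 - m' = (n' - m').+1 by lia.
    have -> : m - (n + 1) = 0 by lia.
    have -> : m' - (n' + 1) = 0 by lia.
    by split=> //; apply: fold_periodS.
move=> [[m n]|] [[m' n']|] // /rhoP[e1 e2 e3] /=.
have le1 := le_eq _ _ _ _ e2; case: (leqP m n) => mn.
  have mn' : m' <= n' by rewrite -le1.
  move: e1; rewrite !le_mn // => e1.
  rewrite -(subnKC mn) -(subnKC mn').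
  rewrite (fold_periodP (rel_periodic_from_diag HR _).1 e1).
  exact: (fold_periodP (rel_periodic_from_off HR _).1 e3).
have mn' : n' < m' by rewrite ltnNge -le1 -ltnNge.
move: e1; rewrite (lt_nm _ _ (ltnW mn)) (lt_nm _ _ (ltnW mn')) => e1.
rewrite -(subnKC (ltnW mn)) -(subnKC (ltnW mn')).
rewrite (fold_periodP (rel_periodic_from_diag HR _).2 e1).
exact: (fold_periodP (rel_periodic_from_off HR _).2 e2).
Qed.

(** * Presentations by injective codings *)

Definition codes (X : Type) (P : X -> Prop) (c : X -> nat) (n : nat) : Prop :=
  exists2 x, P x & c x = n.

Definition coded_rel (X : Type) (P : X -> Prop) (c : X -> nat) (eta : X -> X -> Prop)
    (m n : nat) : Prop :=
  exists x y, [/\ P x, P y, c x = m, c y = n & eta x y].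

(** A predicate [P] on the whole type, instead of a subtype, lets codings of disjoint parts be
    glued. *)
Definition coded_presentation (X : Type) (P : X -> Prop) (eta : X -> X -> Prop) : Prop :=
  exists (c : X -> nat) (N p : nat),
    [/\ forall x y, P x -> P y -> c x = c y -> x = y, 0 < p,
        periodic_from N p (codes P c) & rel_periodic_from N p (coded_rel P c eta)].

(** A pair [m < n] far apart is transported by shifting the larger argument alone, a close pair by
    shifting both. In the close case the threshold [N + N + p] guarantees that [m - p] is still at
    least [N]. *)
Lemma periodic_from_least N p E : rel_periodic_from N p E ->
  periodic_from (N + N + p) p (fun n => E n n /\ forall m, m < n -> ~ E m n).
Proof.
move=> [Ea Eb _] n Nn; rewrite (Ea n n); [|lia|lia].
split=> -[Enn least]; split=> // m mn Emn.
- case: (leqP (m + N).+1 n) => h; first by apply: (least m); [lia | apply/Eb => //; lia].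
  apply: (least (m - p)); first by lia.
  by apply/Ea; [lia | lia | rewrite subnK //; lia].
- case: (leqP (m + N).+1 n) => h; first by apply: (least m); [lia | apply/(Eb m n) => //; lia].
  by apply: (least (m + p)); [lia | apply/(Ea m n) => //; lia].
Qed.

Lemma ex_least (P : nat -> Prop) :
  (exists n, P n) -> exists n, P n /\ forall m, m < n -> ~ P m.
Proof.
case=> n Pn; have exP : exists n, `[< P n >] by exists n; apply/asboolP.
case: (ex_minnP exP) => m /asboolP Pm min_m; exists m; split=> // k km Pk.
by have /min_m : `[< P k >]; [apply/asboolP | lia].
Qed.

(** Each vertex is coded by its least name. Least names are described by the kernel relation [E]
    alone, which makes their set periodic, and the coded edges are [R] restricted to them. *)
Lemma presentable_coded (X : Type) (eta : X -> X -> Prop) :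
  unary_FA_presentable eta -> coded_presentation (fun _ => True) eta.
Proof.
case=> L [phi [_ [surj [/regular_rel_periodic[N1 [p1 [p1_gt0 HE]]]
                        /regular_rel_periodic[N2 [p2 [p2_gt0 HR]]]]]]].
set E := fun m n => _ in HE; set R := fun m n => _ in HR.
have HL := periodic_from_least HE.
pose nm x n := exists h : L n, phi (exist _ n h) = x.
have /choice[c Hc] : forall x, exists n, nm x n /\ forall m, m < n -> ~ nm x m.
  move=> x; apply: (@ex_least (nm x)); have [[n h] e] := surj x.
  by exists n, h.
have nm_fun n x y : nm x n -> nm y n -> x = y.
  by move=> [h <-] [h' <-]; congr (phi (exist _ n _)); apply: Prop_irrelevance.
have cP n : codes (fun _ => True) c n <-> E n n /\ (forall m, m < n -> ~ E m n).
  split=> [[x _ <-]|[[h [_ _]] least]].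
    have [[h e] least] := Hc x; split; first by exists h, h.
    move=> m mc [hm [hn e']]; apply: (least m mc); exists hm; rewrite e' -[RHS]e.
    by congr (phi (exist _ _ _)); apply: Prop_irrelevance.
  exists (phi (exist _ n h)) => //.
  have [[h' e] least'] := Hc (phi (exist _ n h)).
  case: (ltngtP (c (phi (exist _ n h))) n) => // lt.
    by case: (least _ lt); exists h', h.
  by case: (least' _ lt); exists h.
pose C := codes (fun _ => True) c.
have RP m n : coded_rel (fun _ => True) c eta m n <-> C m /\ C n /\ R m n.
  split=> [[x [y [_ _ <- <- exy]]]|[[x _ <-] [[y _ <-] [hm [hn]]]]].
    split; first by exists x.
    split; first by exists y.
    by have [[h e] _] := Hc x; have [[h' e'] _] := Hc y; exists h, h'; rewrite e e'.
  have [e _] := Hc x; have [e' _] := Hc y => H; exists x, y; split=> //.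
  by rewrite (nm_fun _ _ _ (ex_intro _ hm erefl) e) (nm_fun _ _ _ (ex_intro _ hn erefl) e') in H.
have CE : C = (fun n => E n n /\ (forall m, m < n -> ~ E m n)).
  by apply/funext => n; apply/propext.
have RE : coded_rel (fun _ => True) c eta = (fun m n => C m /\ C n /\ R m n).
  by apply/funext => m; apply/funext => n; apply/propext.
pose N := maxn (N1 + N1 + p1) N2.
have HC : periodic_from N (p1 * p2) C.
  by rewrite CE; apply: periodic_from_weaken HL; [exact: leq_maxl | exact: dvdn_mulr].
exists c, N, (p1 * p2); split=> //.
- move=> x y _ _ e; have [Hx _] := Hc x; have [Hy _] := Hc y.
  by apply: (nm_fun (c x)) => //; rewrite e.
- by rewrite muln_gt0 p1_gt0.
rewrite RE; apply: rel_periodic_from_restrict HC _.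
by apply: rel_periodic_from_weaken HR; [exact: leq_maxr | exact: dvdn_mull].
Qed.

Lemma coded_presentable (X : Type) (eta : X -> X -> Prop) :
  coded_presentation (fun _ => True) eta -> unary_FA_presentable eta.
Proof.
case=> c [N [p [inj p0 HC HR]]].
pose C := codes (fun _ => True) c.
have /choice[phi phiP] : forall u : {n | C n}, exists x, c x = sval u.
  by case=> n Cn; have [x _ e] := Cn; exists x.
have Cc x : C (c x) by exists x.
have phic x (h : C (c x)) : phi (exist _ (c x) h) = x by apply: inj => //; rewrite phiP.
exists C, phi; split; first exact: periodic_unary_regular p0 HC.
split; first by move=> x; exists (exist _ (c x) (Cc x)).
split.
  have -> : (fun m n => exists (hm : C m) (hn : C n),
      phi (exist _ m hm) = phi (exist _ n hn)) = (fun m n => C m /\ m = n).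
    apply/funext => m; apply/funext => n; apply/propext; split=> [[hm [hn e]]|[hm e]].
      by split=> //; have := congr1 c e; rewrite !phiP.
    by case: n / e; exists hm, hm.
  (* Equality fails at every positive gap; [N.+1] keeps the gap 0 out of the last two clauses. *)
  apply: (@periodic_regular_rel N.+1 p) => //; split=> m n.
  - by move=> Nm Nn; have := HC m (ltnW Nm); split=> -[? ?]; split; try tauto; lia.
  - by move=> mn; split=> -[? ?]; lia.
  - by move=> nm; split=> -[? ?]; lia.
apply: (@periodic_regular_rel N p) => //.
suff -> : (fun m n => exists (hm : C m) (hn : C n),
    eta (phi (exist _ m hm)) (phi (exist _ n hn))) = coded_rel (fun _ => True) c eta by [].
apply/funext => m; apply/funext => n; apply/propext; split=> [[hm [hn e]]|].
  by exists (phi (exist _ m hm)), (phi (exist _ n hn)); rewrite !phiP.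
case=> x [y [_ _ <- <- e]].
by exists (Cc x), (Cc y); rewrite !phic.
Qed.

Lemma coded_sig (X : Type) (P : X -> Prop) (eta : X -> X -> Prop) :
  coded_presentation P eta <->
  coded_presentation (fun _ => True) (fun u v : {x | P x} => eta (sval u) (sval v)).
Proof.
split=> -[c [N [p [inj p0 HC HR]]]].
  exists (fun u => c (sval u)), N, p.
  have CE : codes (fun _ => True) (fun u : {x | P x} => c (sval u)) = codes P c.
    apply/funext => n; apply/propext; split=> [[[x Px] _ <-]|[x Px <-]]; first by exists x.
    by exists (exist _ x Px).
  have RE : coded_rel (fun _ => True) (fun u : {x | P x} => c (sval u))
      (fun u v => eta (sval u) (sval v)) = coded_rel P c eta.
    apply/funext => m; apply/funext => n; apply/propext; split.
      by case=> [[x Px] [[y Py] [_ _ <- <- e]]]; exists x, y.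
    by case=> x [y [Px Py <- <- e]]; exists (exist _ x Px), (exist _ y Py).
  rewrite CE RE; split=> // -[x Px] [y Py] _ _ /= /(inj _ _ Px Py) e.
  by case: y / e Py => Py; congr exist; apply: Prop_irrelevance.
(* Off [P] the value 0 is a placeholder. *)
pose d x := if pselect (P x) is left h then c (exist _ x h) else 0.
have dE x (h : P x) : d x = c (exist _ x h).
  rewrite /d; case: pselect => // h'.
  by congr (c (exist _ _ _)); apply: Prop_irrelevance.
exists d, N, p.
have CE : codes P d = codes (fun _ => True) c.
  apply/funext => n; apply/propext; split=> [[x Px <-]|[[x Px] _ <-]].
    by exists (exist _ x Px).
  by exists x.
have RE : coded_rel P d eta =
    coded_rel (fun _ => True) c (fun u v : {x | P x} => eta (sval u) (sval v)).
  apply/funext => m; apply/funext => n; apply/propext; split.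
    by case=> x [y [Px Py <- <- e]]; exists (exist _ x Px), (exist _ y Py).
  by case=> [[x Px] [[y Py] [_ _ <- <- e]]]; exists x, y; split.
rewrite CE RE; split=> // x y Px Py; rewrite (dE x Px) (dE y Py).
by move=> /(inj _ _ I I) /(congr1 sval).
Qed.

Lemma presentable_sigP (X : Type) (P : X -> Prop) (eta : X -> X -> Prop) :
  unary_FA_presentable (fun u v : {x | P x} => eta (sval u) (sval v)) <->
  coded_presentation P eta.
Proof.
rewrite coded_sig; split; [exact: presentable_coded | exact: coded_presentable].
Qed.

Lemma coded_presentation_empty (X : Type) (P : X -> Prop) (eta : X -> X -> Prop) :
  (forall x, ~ P x) -> coded_presentation P eta.
Proof.
move=> P0; exists (fun _ => 0), 0, 1; split=> //.
- by move=> x y /P0.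
- by move=> n _; split=> -[x /P0].
by split=> *; split=> -[x [y [/P0]]].
Qed.

(* The two parts are coded by the even and the odd numbers. *)
Lemma coded_presentation_union (X : Type) (P Q : X -> Prop) (eta : X -> X -> Prop) :
  (forall x, P x -> ~ Q x) -> (forall x y, P x -> Q y -> ~ und eta x y) ->
  coded_presentation P eta -> coded_presentation Q eta ->
  coded_presentation (fun x => P x \/ Q x) eta.
Proof.
move=> PQ sep [c [N [p [inj p0 HC HR]]]] [d [N' [p' [inj' p'0 HD HR']]]].
pose M := maxn N N'; pose r := p * p'.
have r0 : 0 < r by rewrite muln_gt0 p0.
have {}HC : periodic_from M r (codes P c).
  by apply: periodic_from_weaken HC; [exact: leq_maxl | exact: dvdn_mulr].
have {}HD : periodic_from M r (codes Q d).
  by apply: periodic_from_weaken HD; [exact: leq_maxr | exact: dvdn_mull].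
have {}HR : rel_periodic_from M r (coded_rel P c eta).
  by apply: rel_periodic_from_weaken HR; [exact: leq_maxl | exact: dvdn_mulr].
have {}HR' : rel_periodic_from M r (coded_rel Q d eta).
  by apply: rel_periodic_from_weaken HR'; [exact: leq_maxr | exact: dvdn_mull].
pose e x := if `[< P x >] then (c x).*2 else (d x).*2.+1.
have eP x : P x -> e x = (c x).*2 by move=> Px; rewrite /e asboolT.
have eQ x : Q x -> e x = (d x).*2.+1.
  by move=> Qx; rewrite /e asboolF // => Px; apply: (PQ x).
have C0 k : codes (fun x => P x \/ Q x) e k.*2 <-> codes P c k.
  split=> [[x [Px|Qx]]|[x Px <-]]; last by exists x; [left | rewrite eP].
    by rewrite eP // => ?; exists x => //; lia.
  by rewrite eQ //; lia.
have C1 k : codes (fun x => P x \/ Q x) e k.*2.+1 <-> codes Q d k.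
  split=> [[x [Px|Qx]]|[x Qx <-]]; last by exists x; [right | rewrite eQ].
    by rewrite eP //; lia.
  by rewrite eQ // => ?; exists x => //; lia.
pose S := coded_rel (fun x => P x \/ Q x) e eta.
have S00 k l : S k.*2 l.*2 <-> coded_rel P c eta k l.
  split=> [[x [y [[Px|Qx] [Py|Qy]]]]|[x [y [Px Py <- <- exy]]]].
  - by rewrite !eP // => ? ? ?; exists x, y; split=> //; lia.
  - by rewrite (eQ y) //; lia.
  - by rewrite (eQ x) //; lia.
  - by rewrite (eQ x) //; lia.
  - by exists x, y; rewrite !eP //; split=> //; left.
have S11 k l : S k.*2.+1 l.*2.+1 <-> coded_rel Q d eta k l.
  split=> [[x [y [[Px|Qx] [Py|Qy]]]]|[x [y [Qx Qy <- <- exy]]]].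
  - by rewrite (eP x) //; lia.
  - by rewrite (eP x) //; lia.
  - by rewrite (eP y) //; lia.
  - by rewrite !eQ // => ? ? ?; exists x, y; split=> //; lia.
  - by exists x, y; rewrite !eQ //; split=> //; right.
have S01 k l : ~ S k.*2 l.*2.+1.
  case=> x [y [[Px|Qx] [Py|Qy] ex ey exy]].
  - by move: ey; rewrite eP //; lia.
  - by apply: (sep x y) => //; left.
  - by move: ex; rewrite eQ //; lia.
  - by move: ex; rewrite eQ //; lia.
have S10 k l : ~ S k.*2.+1 l.*2.
  case=> x [y [[Px|Qx] [Py|Qy] ex ey exy]].
  - by move: ex; rewrite eP //; lia.
  - by move: ex; rewrite eP //; lia.
  - by apply: (sep y x) => //; right.
  - by move: ey; rewrite eQ //; lia.
have parity n : exists k, n = k.*2 \/ n = k.*2.+1.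
  by exists n./2; rewrite -{1 3}(odd_double_half n); case: (odd n); [right|left].
exists e, M.*2, r.*2; split.
- move=> x y [Px|Qx] [Py|Qy].
  + by rewrite !eP // => h; apply: inj => //; lia.
  + by rewrite eP // eQ //; lia.
  + by rewrite eQ // eP //; lia.
  + by rewrite !eQ // => h; apply: inj' => //; lia.
- by lia.
- move=> n Mn; have [k [kE|kE]] := parity n; rewrite kE ?addSn -doubleD.
    by rewrite !C0; apply: HC; lia.
  by rewrite !C1; apply: HD; lia.
case: HR HR' => [Ra Rb Rc] [Ra' Rb' Rc'].
rewrite -/S; split=> m n; have [k [->|->]] := parity m; have [l [->|->]] := parity n;
  rewrite ?addSn -?doubleD ?S00 ?S11;
  try (by move=> *; split=> /S01); try (by move=> *; split=> /S10).
- by move=> ? ?; apply: Ra; lia.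
- by move=> ? ?; apply: Ra'; lia.
- by move=> ?; apply: Rb; lia.
- by move=> ?; apply: Rb'; lia.
- by move=> ?; apply: Rc; lia.
- by move=> ?; apply: Rc'; lia.
Qed.

Lemma coded_presentation_ext (X : Type) (P Q : X -> Prop) (eta : X -> X -> Prop) :
  (forall x, P x <-> Q x) -> coded_presentation P eta -> coded_presentation Q eta.
Proof.
by move=> PQ; have -> : P = Q by apply/funext => x; apply/propext.
Qed.

Lemma coded_presentation_fibers (X : Type) (eta : X -> X -> Prop) (g : X -> nat) K :
  (forall x, g x < K) -> (forall x y, eta x y -> g x = g y) ->
  (forall k, k < K -> coded_presentation (fun x => g x = k) eta) ->
  coded_presentation (fun _ => True) eta.
Proof.
move=> gK geta Hk; apply: (@coded_presentation_ext _ (fun x => g x < K)) => //.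
elim: {gK} K Hk => [|K IHK] Hk; first exact: coded_presentation_empty.
apply: (@coded_presentation_ext _ (fun x => g x < K \/ g x = K)).
  by move=> x; split=> [[]|]; lia.
apply: coded_presentation_union.
- by move=> x h ?; lia.
- by move=> x y h h' [/geta|/geta]; lia.
- by apply: IHK => k kK; apply: Hk; lia.
- by apply: Hk.
Qed.

(** * Components of a presentable forest *)

Lemma und_sym (X : Type) (E : X -> X -> Prop) x y : und E x y -> und E y x.
Proof. by case; [right | left]. Qed.

Lemma connected_trans (X : Type) (E : X -> X -> Prop) x y z :
  connected E x y -> connected E y z -> connected E x z.
Proof. by move=> xy; elim=> // u v _ xu; apply: conn_step xu. Qed.

Lemma connected_und (X : Type) (E : X -> X -> Prop) x y : und E x y -> connected E x y.
Proof. exact: conn_step (conn_refl _ _). Qed.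

Lemma connected_sym (X : Type) (E : X -> X -> Prop) x y :
  connected E x y -> connected E y x.
Proof.
elim=> [|u v _ xu uv]; first exact: conn_refl.
exact: connected_trans (connected_und (und_sym uv)) xu.
Qed.

Lemma bounded_choice (Q : nat -> nat -> Prop) d :
  (forall r N N', N <= N' -> Q r N -> Q r N') -> (forall r, r < d -> exists N, Q r N) ->
  exists N, forall r, r < d -> Q r N.
Proof.
move=> mono; elim: d => [|d IHd] HQ; first by exists 0.
have [|N HN] := IHd; first by move=> r rd; apply: HQ; lia.
have [N' HN'] := HQ d (leqnn _); exists (maxn N N') => r rd.
case: (ltngtP r d) => [lt|gt|->]; [|by lia|].
  by apply: mono (HN r lt); exact: leq_maxl.
by apply: mono HN'; exact: leq_maxr.
Qed.

(** By injectivity the list grows by at most one element for each value of [g]. *)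
Lemma bounded_list (X : Type) (P : X -> Prop) (g : X -> nat) k :
  (forall x y, P x -> P y -> g x = g y -> x = y) -> (forall x, P x -> g x < k) ->
  exists s : seq X, size s <= k /\ forall y, P y -> List.In y s.
Proof.
move=> inj gk; suff [s [sk Ps]] : exists s : seq X,
    size s <= k /\ forall y, P y -> g y < k -> List.In y s.
  by exists s; split=> // y Py; apply: Ps (gk _ Py).
elim: {gk} k => [|k [s [sk Ps]]]; first by exists [::].
case: (pselect (exists2 x, P x & g x = k)) => [[x Px gx]|nx].
  exists (x :: s); split=> // y Py; rewrite ltnS leq_eqVlt => /orP[/eqP gy|].
    by left; apply: inj; rewrite ?gx.
  by right; apply: Ps.
exists s; split=> [|y Py]; first by lia.
rewrite ltnS leq_eqVlt => /orP[/eqP gy|]; last exact: Ps.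
by case: nx; exists y.
Qed.

Lemma In_leq_sumn n s : List.In n s -> n <= sumn s.
Proof. by elim: s => //= m s IHs [->|/IHs]; lia. Qed.

(** * Eventually periodic sets *)

Definition eventually_periodic (S : nat -> Prop) : Prop :=
  exists N p, 0 < p /\ periodic_from N p S.

Lemma bounded_eventually_periodic S N :
  (forall n, S n -> n < N) -> eventually_periodic S.
Proof. by move=> HS; exists N, 1; split=> // n Nn; split=> /HS; lia. Qed.

Lemma eventually_periodicU S T : eventually_periodic S -> eventually_periodic T ->
  eventually_periodic (fun n => S n \/ T n).
Proof.
move=> [N [p [p0 HS]]] [N' [p' [p'0 HT]]]; exists (maxn N N'), (p * p').
split; first by rewrite muln_gt0 p0.
move=> n Nn.
have := periodic_from_weaken (leq_maxl N N') (dvdn_mulr p' (dvdnn p)) HS Nn.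
have := periodic_from_weaken (leq_maxr N N') (dvdn_mull p (dvdnn p')) HT Nn.
tauto.
Qed.

Lemma eventually_periodic_bigU (S : nat -> nat -> Prop) d :
  (forall z, eventually_periodic (S z)) ->
  eventually_periodic (fun n => exists z, z < d /\ S z n).
Proof.
move=> HS; elim: d => [|d IHd]; first by apply: (@bounded_eventually_periodic _ 0) => n [z []].
suff -> : (fun n => exists z, z < d.+1 /\ S z n) =
          (fun n => (exists z, z < d /\ S z n) \/ S d n) by apply: eventually_periodicU.
apply/funext => n; apply/propext; split=> [[z [zd Sz]]|[[z [zd Sz]]|Sd]].
- by case: (ltngtP z d) => [lt|gt|e]; [left; exists z | lia | right; rewrite -e].
- by exists z; split=> //; lia.
- by exists d.
Qed.

(** In each residue class modulo [d] the set is empty or contains the whole class from some point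
    on; the finitely many classes share a threshold. *)
Lemma upward_eventually_periodic S d : 0 < d -> (forall n, S n -> S (n + d)) ->
  eventually_periodic S.
Proof.
move=> d0 up; pose Q r N := forall n, S n -> n %% d = r ->
  exists m, [/\ m <= N, S m & m %% d = r].
have [|r _|N HN] := @bounded_choice Q d.
- move=> r N N' NN' HQ n Sn nr; have [m [mN Sm mr]] := HQ n Sn nr.
  by exists m; split=> //; lia.
- case: (pselect (exists2 n, S n & n %% d = r)) => [[n Sn nr]|nS].
    by exists n => _ _ _; exists n.
  by exists 0 => n Sn nr; case: nS; exists n.
exists N, d; split=> // n Nn; split; first exact: up.
move=> Sn; have [|m [mN Sm mr]] := HN (n %% d) (ltn_pmod _ d0) _ Sn.
  by rewrite modnDr.
have /dvdnP[k kE] : d %| n - m by rewrite -eqn_mod_dvd ?mr //; lia.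
have -> : n = m + k * d by lia.
elim: k {kE} => [|k IHk]; first by rewrite mul0n addn0.
by rewrite mulSn addnCA addnC; apply: up.
Qed.

(** For a component, the first case will produce an infinite progression inside it, and the second
    leaves at most [q] vertices. *)
Lemma residue_dichotomy (S : nat -> Prop) q :
  (exists m k, [/\ 0 < k, S m & S (m + k * q)]) \/
  (forall m n, S m -> S n -> m %% q = n %% q -> m = n).
Proof.
case: (pselect (exists m k, [/\ 0 < k, S m & S (m + k * q)])) => [|H]; first by left.
right=> m n; wlog mn : m n / m <= n.
  by move=> W Sm Sn e; case: (leqP m n) => [|/ltnW] h; [apply: W | symmetry; apply: W].
move=> Sm Sn e; case: (ltngtP m n) => // [lt|]; last by lia.
have /dvdnP[k kE] : q %| n - m by rewrite -eqn_mod_dvd ?e.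
case: H; exists m, k; split=> //; last by rewrite -kE subnKC.
by case: k kE => //; lia.
Qed.

(** * Graphs that are periodic above a finite core *)

(** The codes below [q] form the core. Above it edges are short and can be shifted upwards; an edge
    from the core to a code at least [q + q] can be moved at its upper end. *)
Record layered (q : nat) (R : nat -> nat -> Prop) : Prop := Layered {
  layered_gt0 : 0 < q;
  layered_shift : forall m n, q <= m -> q <= n -> und R m n -> und R (m + q) (n + q);
  layered_fan : forall m n, m < q -> q + q <= n -> und R m n -> und R m (n + q);
  layered_short : forall m n, q <= m -> q <= n -> und R m n -> n < m + q }.

Definition upper_rel (q : nat) (R : nat -> nat -> Prop) (m n : nat) : Prop :=
  [/\ q <= m, q <= n & und R m n].

Lemma und_upper_rel q R m n : und (upper_rel q R) m n -> upper_rel q R m n.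
Proof. by case=> // -[qn qm nm]; split=> //; apply: und_sym. Qed.

Lemma upper_sub q R m n : connected (upper_rel q R) m n -> connected R m n.
Proof.
elim=> [|u v _ mu /und_upper_rel[_ _ uv]]; [exact: conn_refl | exact: conn_step uv].
Qed.

Lemma upper_shift q R m n k : layered q R ->
  connected (upper_rel q R) m n -> connected (upper_rel q R) (m + k * q) (n + k * q).
Proof.
move=> lay; elim: k m n => [|k IHk] m n mn; first by rewrite !mul0n !addn0.
rewrite mulSn !addnA; apply: IHk.
elim: mn => [|u v _ mu /und_upper_rel[qu qv uv]]; first exact: conn_refl.
apply: conn_step mu _; left; split; [lia | lia |].
exact: layered_shift lay _ _ qu qv uv.
Qed.

Lemma upper_iter q R m k j : layered q R -> connected (upper_rel q R) m (m + k * q) ->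
  connected (upper_rel q R) m (m + j * k * q).
Proof.
move=> lay mk; elim: j => [|j IHj]; first by rewrite !mul0n addn0; exact: conn_refl.
apply: connected_trans mk _; rewrite mulSn mulnDl addnA (addnAC m).
exact: upper_shift.
Qed.

(** If the component contains [m] and [m + k * q], a connection from [m] to [n] can be shifted and
    joined at [m + k * q], which shows closure under adding [k * q]. Otherwise its elements are
    incongruent modulo [q], and it is finite. *)
Lemma upper_component_periodic q R z : layered q R ->
  eventually_periodic (connected (upper_rel q R) z).
Proof.
move=> lay; have q0 := layered_gt0 lay.
case: (residue_dichotomy (connected (upper_rel q R) z) q) => [[m [k [k0 zm zmk]]]|uniq_res].
  apply: (@upward_eventually_periodic _ (k * q)); first by rewrite muln_gt0 k0.
  move=> n zn; apply: connected_trans zmk _; apply: upper_shift => //.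
  exact: connected_trans (connected_sym zm) zn.
have [|s [_ Hs]] := bounded_list uniq_res (k := q); first by move=> n _; exact: ltn_pmod.
apply: (@bounded_eventually_periodic _ (sumn s).+1) => n /Hs.
exact: In_leq_sumn.
Qed.

(** Outside the core, the component is a union of components of [upper_rel]. Those attached to the
    core at or above [q + q] together form a set closed under adding [q]; the remaining ones are
    finitely many. *)
Lemma component_periodic q R x : layered q R -> eventually_periodic (connected R x).
Proof.
move=> lay; pose H := connected (upper_rel q R).
pose fan n := exists z v, [/\ H n z, q + q <= z, v < q, connected R x v & und R v z].
pose low n := exists z, z < q + q /\ (connected R x z /\ H z n).
suff -> : connected R x = (fun n => (n < q /\ connected R x n) \/ (fan n \/ (low n \/ H x n))).
  apply: eventually_periodicU.
    by apply: (@bounded_eventually_periodic _ q) => n [].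
  apply: eventually_periodicU.
    (* The attaching edge moves by [layered_fan], the rest of the path by [upper_shift]. *)
    apply: (upward_eventually_periodic (layered_gt0 lay)) => n [z [v [nz qz vq xv vz]]].
    exists (z + q), v; split=> //; [|by lia|exact: layered_fan lay _ _ vq qz vz].
    by have := upper_shift 1 lay nz; rewrite !mul1n.
  apply: eventually_periodicU; last exact: upper_component_periodic.
  apply: eventually_periodic_bigU => z.
  case: (pselect (connected R x z)) => [xz|nxz].
    have -> : (fun n => connected R x z /\ H z n) = H z.
      by apply/funext => n; apply/propext; split=> [[]|].
    exact: upper_component_periodic.
  by apply: (@bounded_eventually_periodic _ 0) => n [].
apply/funext => n; apply/propext; split; last first.
  case=> [[]//|[[z [v [nz _ _ xv vz]]]|[[z [_ [xz zn]]]|]]].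
  - by apply: connected_trans (conn_step xv vz) (connected_sym (upper_sub nz)).
  - exact: connected_trans xz (upper_sub zn).
  - exact: upper_sub.
(* Induction along the walk: on leaving the core it enters [fan] or [low] according to the size of
   the entry point, and it stays in that piece until it returns to the core. *)
elim=> [|y z xy IHy yz]; first by right; right; right; exact: conn_refl.
case: (ltnP z q) => zq; first by left; split=> //; apply: conn_step yz.
right; case: (ltnP y q) => yq.
  case: (ltnP z (q + q)) => zqq.
    by right; left; exists z; split=> //; split; [apply: conn_step yz | exact: conn_refl].
  by left; exists z, y; split=> //; exact: conn_refl.
have Hyz : und (upper_rel q R) y z by left.
case: IHy => [[]|[[u [v [yu qu vq xv vu]]]|[[u [uq [xu uy]]]|xy']]]; first by lia.
- left; exists u, v; split=> //.
  exact: connected_trans (connected_und (und_sym Hyz)) yu.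
- by right; left; exists u; split=> //; split=> //; apply: conn_step Hyz.
- by right; right; apply: conn_step Hyz.
Qed.

Lemma coded_connected (X : Type) (eta : X -> X -> Prop) (c : X -> nat) x n :
  injective c -> (connected (coded_rel (fun _ => True) c eta) (c x) n <->
                  exists2 y, c y = n & connected eta x y).
Proof.
move=> inj; split=> [|[y <-]].
  elim=> [|u v _ [y <- xy]]; first by exists x => //; exact: conn_refl.
  case=> -[a [b [_ _ ea eb ab]]].
    by exists b => //; apply: conn_step xy _; left; rewrite -(inj _ _ ea).
  by exists a => //; apply: conn_step xy _; right; rewrite -(inj _ _ eb).
elim=> [|u v _ xu uv]; first exact: conn_refl.
by apply: conn_step xu _; case: uv => uv; [left; exists u, v | right; exists v, u].
Qed.

Lemma forest_layered (X : Type) (eta : X -> X -> Prop) :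
  directed_forest eta -> coded_presentation (fun _ => True) eta ->
  exists (c : X -> nat) (q : nat),
    [/\ injective c, rel_periodic_from q q (coded_rel (fun _ => True) c eta) &
        layered q (coded_rel (fun _ => True) c eta)].
Proof.
move=> [_ [_ acyc]] [c [N [p [inj0 p0 _ HR]]]].
have inj : injective c by move=> x y; apply: inj0.
(* A multiple of [p] that is at least [N] serves as threshold and period at once. *)
pose q := p * N.+1; have q0 : 0 < q by rewrite muln_gt0 p0.
have Nq : N <= q by rewrite /q; nia.
have pq : p %| q by rewrite dvdn_mulr.
exists c, q; set R := coded_rel _ c eta.
have {}HR := rel_periodic_from_weaken Nq pq HR.
split=> //; case: HR => [Ra Rb Rc].
have shift m n : q <= m -> q <= n -> und R m n -> und R (m + q) (n + q).
  by move=> qm qn [/(Ra _ _ qm qn)|/(Ra _ _ qn qm)] ?; [left | right].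
have fan m n : m + q <= n -> und R m n -> und R m (n + q).
  by move=> mn [/(Rb _ _ mn)|/(Rc _ _ mn)] ?; [left | right].
split=> //; first by move=> m n mq qn; apply: fan; lia.
move=> m n qm qn mn; case: (ltnP n (m + q)) => // far.
have lift a b x : c x = a -> und R a b -> exists2 y, c y = b & und eta x y.
  move=> <- [[u [v [_ _ /inj <- <- uv]]]|[u [v [_ _ <- /inj <- uv]]]].
    by exists v => //; left.
  by exists u => //; right.
have [x cx] : exists x, c x = m.
  by case: mn => [[u [v [_ _ <- _ _]]]|[u [v [_ _ _ <- _]]]]; [exists u | exists v].
(* A long edge yields the closed walk [m], [n + q], [m + q], [n + q + q], whose four codes are
   distinct since [m + q <= n]. *)
have e1 : und R m (n + q) by apply: fan.
have e2 : und R (n + q) (m + q) by apply: und_sym; apply: shift.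
have e3 : und R (m + q) (n + q + q) by apply: shift => //; lia.
have e4 : und R (n + q + q) m by apply: und_sym; apply: fan => //; lia.
have [y cy xy] := lift _ _ _ cx e1; have [z cz yz] := lift _ _ _ cy e2.
have [w cw zw] := lift _ _ _ cz e3; have [x' cx' wx] := lift _ _ _ cw e4.
have ex : x' = x by apply: inj; rewrite cx'.
case: (acyc x [:: y; z; w]) => //; last by rewrite /= -ex.
apply: (List.NoDup_map_inv c); rewrite /= cx cy cz cw.
by repeat constructor => /=; lia.
Qed.

Lemma presentable_component (X : Type) (eta : X -> X -> Prop) x :
  directed_forest eta -> coded_presentation (fun _ => True) eta ->
  coded_presentation (connected eta x) eta.
Proof.
move=> forest /(forest_layered forest)[c [q [inj HR lay]]].
set R := coded_rel _ c eta in HR lay.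
have [N [p [p0 HS]]] := component_periodic (c x) lay.
have CE : codes (connected eta x) c = connected R (c x).
  apply/funext => n; apply/propext; rewrite (coded_connected _ _ _ inj).
  by split=> -[y]; exists y.
have RE : coded_rel (connected eta x) c eta =
    (fun m n => connected R (c x) m /\ connected R (c x) n /\ R m n).
  apply/funext => m; apply/funext => n; apply/propext; split.
    case=> y [z [xy xz <- <- yz]]; split; first by apply/coded_connected => //; exists y.
    split; first by apply/coded_connected => //; exists z.
    by exists y, z.
  case=> /(coded_connected _ _ _ inj)[y <- xy] [/(coded_connected _ _ _ inj)[z <- xz]].
  by case=> u [v [_ _ /inj -> /inj -> uv]]; exists y, z.
have q0 := layered_gt0 lay.
exists c, (maxn q N), (q * p); split.
- by move=> y z _ _; apply: inj.
- by rewrite muln_gt0 q0.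
- by rewrite CE; apply: periodic_from_weaken HS; [exact: leq_maxr | exact: dvdn_mull].
rewrite RE; apply: rel_periodic_from_restrict.
  by apply: periodic_from_weaken HS; [exact: leq_maxr | exact: dvdn_mull].
by apply: rel_periodic_from_weaken HR; [exact: leq_maxl | exact: dvdn_mulr].
Qed.

Lemma finite_component_connected (X : Type) (eta : X -> X -> Prop) x y :
  connected eta x y -> finite_pred (connected eta x) -> finite_pred (connected eta y).
Proof.
by move=> xy [s Hs]; exists s => z yz; apply: Hs; apply: connected_trans xy yz.
Qed.

Lemma connected_upper q R m n : (forall k, connected R m k -> q <= k) ->
  connected R m n -> connected (upper_rel q R) m n.
Proof.
move=> up; elim=> [|u v mu IHu uv]; first exact: conn_refl.
apply: conn_step IHu _; left; split=> //; apply: up => //.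
exact: conn_step uv.
Qed.

Lemma finite_pred_code_bound (X : Type) (P : X -> Prop) (c : X -> nat) :
  finite_pred P -> exists B, forall x, P x -> c x <= B.
Proof.
case=> s Hs; exists (sumn (map c s)) => x /Hs /(List.in_map c).
exact: In_leq_sumn.
Qed.

(** At most [q] finite components meet the core, and the largest of them gives one bound; in the
    others the codes are incongruent modulo [q], which gives the bound [q]. *)
Lemma presentable_finite_components_bounded (X : Type) (eta : X -> X -> Prop) :
  directed_forest eta -> coded_presentation (fun _ => True) eta ->
  finite_components_bounded eta.
Proof.
move=> forest /(forest_layered forest)[c [q [inj _ lay]]].
have q0 := layered_gt0 lay; set R := coded_rel _ c eta in lay.
pose small x N := exists s : seq X, size s <= N /\ forall y, connected eta x y -> List.In y s.
pose Q v N := forall x, c x = v -> finite_pred (connected eta x) -> small x N.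
have [|v _|N HN] := @bounded_choice Q q.
- move=> v N N' NN' HQ x cx fx; have [s [sN Hs]] := HQ x cx fx.
  by exists s; split=> //; lia.
- case: (pselect (exists2 x, c x = v & finite_pred (connected eta x))) => [[x cx [s Hs]]|nx].
    by exists (size s) => y; rewrite -cx => /inj -> _; exists s.
  by exists 0 => x cx fx; case: nx; exists x.
exists (maxn N q) => x fx.
case: (pselect (exists2 y, connected eta x y & c y < q)) => [[y xy yq]|high].
  have [s [sN Hs]] := HN _ yq y erefl (finite_component_connected xy fx).
  exists s; split=> [|z xz]; first by lia.
  by apply: Hs; apply: connected_trans (connected_sym xy) xz.
have {}high n : connected R (c x) n -> q <= n.
  move/(coded_connected _ _ _ inj) => [y <- xy].
  by rewrite leqNgt; apply/negP => yq; apply: high; exists y.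
case: (residue_dichotomy (connected R (c x)) q) => [[m [k [k0 xm xmk]]]|uniq_res].
  have [B HB] := finite_pred_code_bound c fx.
  have mk : connected (upper_rel q R) m (m + k * q).
    apply: connected_upper => [n mn|]; first by apply: high; apply: connected_trans xm mn.
    exact: connected_trans (connected_sym xm) xmk.
  (* As [B] bounds the codes of the component, [B.+1] rounds of the progression exceed them all. *)
  have /(connected_trans xm) := upper_sub (upper_iter B.+1 lay mk).
  by case/(coded_connected _ _ _ inj) => y cy /HB; rewrite cy; nia.
have [y z xy xz e|y xy|s [sq Hs]] :=
  @bounded_list _ (connected eta x) (fun y => c y %% q) q.
- apply: (inj); apply: uniq_res e; apply/coded_connected => //; first by exists y.
  by exists z.
- exact: ltn_pmod.
by exists s; split=> //; lia.
Qed.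

(** * Counting the infinite components *)

Definition high_unbounded (q : nat) (R : nat -> nat -> Prop) (x : nat) : Prop :=
  (forall m, connected R x m -> q <= m) /\ (forall k, exists2 m, k <= m & connected R x m).

(** A path that starts at or below [k] and ends at or above it cannot jump over a window of length
    [q], because its edges are shorter than [q]. *)
Lemma window_meets q R x k : layered q R -> high_unbounded q R x -> x <= k ->
  exists m, [/\ k <= m, m < k + q & connected R x m].
Proof.
move=> lay [high unb] xk; have q0 := layered_gt0 lay.
have [n kn xn] := unb k.
(* Invariant along the path: the current vertex is still below [k], or the window has been met. *)
suff : n < k \/ exists m, [/\ k <= m, m < k + q & connected R x m] by case=> //; lia.
elim: xn {kn} => [|y z xy IHy yz].
  by case: (ltngtP x k) xk => // [|->] _; [left | right; exists k; split; [|lia|exact: conn_refl]].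
case: IHy => [yk|]; last by right.
have xz : connected R x z := conn_step xy yz.
have := layered_short lay (high _ xy) (high _ xz) yz.
by case: (ltnP z k) => zk; [left | right; exists z; split=> //; lia].
Qed.

(* Pairwise disconnected components of this kind all meet a common window of length [q]. *)
Lemma high_unbounded_reps q R : layered q R ->
  exists l : seq nat, forall x, high_unbounded q R x -> exists2 r, r \in l & connected R r x.
Proof.
move=> lay; pose indep := pairwise (fun a b => ~~ `[< connected R a b >]).
have small (l : seq nat) : {in l, forall x, high_unbounded q R x} -> indep l -> size l <= q.
  (* The sum bounds every entry of [l], so the window starting there is late enough for all of
     them. *)
  move=> high ind; pose k := sumn l.
  have /choice[h Hh] : forall x, exists m, high_unbounded q R x -> x <= k ->
      [/\ k <= m, m < k + q & connected R x m].
    move=> x; case: (pselect (high_unbounded q R x /\ x <= k)) => [[hx xk]|nx].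
      by have [m Hm] := window_meets lay hx xk; exists m.
    by exists 0 => hx xk; case: nx.
  have Hl x : x \in l -> [/\ k <= h x, h x < k + q & connected R x (h x)].
    move=> xl; apply: Hh; first exact: high.
    rewrite /k; elim: (l) xl => //= y s IHs; rewrite inE => /orP[/eqP ->|/IHs]; lia.
  rewrite -(size_map h) -(size_iota k q); apply: uniq_leq_size; last first.
    by move=> _ /mapP[x /Hl[? ? _] ->]; rewrite mem_iota; lia.
  (* Two entries that meet the window at the same place would be connected, against independence. *)
  move: ind Hl; rewrite /indep; elim: (l) => //= x s IHs /andP[/allP xs ss] Hl.
  rewrite IHs // => [|y ys]; last by apply: Hl; rewrite inE ys orbT.
  rewrite andbT; apply/negP => /mapP[y ys e].
  have /negP := xs y ys; apply; apply/asboolP.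
  have [_ _ xh] := Hl x (mem_head _ _); have [|_ _ yh] := Hl y; first by rewrite inE ys orbT.
  by apply: connected_trans xh _; rewrite e; apply: connected_sym.
pose covers (l : seq nat) := forall x, high_unbounded q R x -> exists2 r, r \in l & connected R r x.
(* An independent list that does not cover can be extended by an uncovered element; with no covering
   list this would reach length [q.+1], which [small] forbids. *)
suff : (exists l, covers l) \/ exists l : seq nat, [/\ size l = q.+1,
    {in l, forall x, high_unbounded q R x} & indep l].
  by case=> // -[l [sl high /(small l high)]]; rewrite sl ltnn.
elim: q.+1 => [|j [|[l [sl high ind]]]]; [by right; exists [::] | by left |].
case: (pselect (covers l)) => [|ncov]; first by left; exists l.
right; have [x hx xl] : exists2 x, high_unbounded q R x & forall r, r \in l -> ~ connected R r x.
  apply: contrapT => nx; apply: ncov => x hx; apply: contrapT => nr; apply: nx.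
  by exists x => // r rl rx; apply: nr; exists r.
exists (x :: l); split; first by rewrite /= sl.
  by move=> y; rewrite inE => /orP[/eqP ->|/high].
rewrite /indep /= -/(indep l) ind andbT; apply/allP => r rl.
by apply/asboolPn => xr; apply: (xl r rl); apply: connected_sym.
Qed.

Lemma presentable_finitely_many_infinite (X : Type) (eta : X -> X -> Prop) :
  directed_forest eta -> coded_presentation (fun _ => True) eta ->
  finitely_many_infinite_components eta.
Proof.
move=> forest /(forest_layered forest)[c [q [inj _ lay]]].
set R := coded_rel _ c eta in lay; have [l Hl] := high_unbounded_reps lay.
(* This bound on the codes takes in the core and every vertex coded by an entry of [l]. *)
have [x y _ _|x h|s [_ Hs]] := @bounded_list _ (fun x => c x < q + (sumn l).+1) c (q + (sumn l).+1).
- exact: inj.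
- exact: h.
exists s => x infx.
case: (pselect (exists2 y, connected eta x y & c y < q)) => [[y xy yq]|high].
  by exists y; [apply: Hs; lia | exact: connected_sym].
have hx : high_unbounded q R (c x).
  split=> [n /(coded_connected _ _ _ inj)[y <- xy]|k].
    by rewrite leqNgt; apply/negP => yq; apply: high; exists y.
  apply: contrapT => nk; apply: infx.
  have [y z _ _|y xy|t [_ Ht]] := @bounded_list _ (connected eta x) c k; [exact: inj| |by exists t].
  rewrite ltnNge; apply/negP => ky; apply: nk; exists (c y) => //.
  by apply/coded_connected => //; exists y.
have [r rl rx] := Hl _ hx.
have [y cy xy] := (coded_connected _ _ _ inj).1 (connected_sym rx).
exists y; last exact: connected_sym.
apply: Hs; rewrite cy; suff : r <= sumn l by lia.
by elim: (l) rl => //= z t IHt; rewrite inE => /orP[/eqP ->|/IHt]; lia.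
Qed.

(** * Forests with bounded finite components *)

(** On [S] this is the increasing enumeration without gaps, by which the copies of one type are
    numbered. *)
Definition rank_in (S : pred nat) (k : nat) : nat := count S (iota 0 k).

Lemma rank_inS (S : pred nat) k : rank_in S k.+1 = rank_in S k + S k.
Proof. by rewrite /rank_in -addn1 iotaD count_cat /= addn0. Qed.

Lemma rank_in_mono (S : pred nat) k l : k <= l -> rank_in S k <= rank_in S l.
Proof. by move/subnKC <-; rewrite /rank_in iotaD count_cat leq_addr. Qed.

Lemma rank_in_inj (S : pred nat) k l : S k -> S l -> rank_in S k = rank_in S l -> k = l.
Proof.
wlog kl : k l / k <= l.
  by move=> W Sk Sl e; case: (leqP k l) => [|/ltnW] h; [apply: W | symmetry; apply: W].
move=> Sk _ e; case: (ltngtP k l) => // [lt|]; last by lia.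
by have := rank_in_mono S lt; rewrite rank_inS Sk e; lia.
Qed.

Lemma rank_in_pred (S : pred nat) k n : rank_in S k = n.+1 -> exists2 l, S l & rank_in S l = n.
Proof.
elim: k => [//|k IHk]; rewrite rank_inS; case Sk: (S k); last by rewrite addn0.
by rewrite addn1 => -[e]; exists k.
Qed.

(** Such a set is everything or bounded, so infinitely many and finitely many copies are treated
    alike. *)
Lemma downward_eventually_constant (I : nat -> Prop) : (forall n, I n.+1 -> I n) ->
  exists N, forall n, N <= n -> (I n <-> I n.+1).
Proof.
move=> down; case: (pselect (forall n, I n)) => [all|/existsNP[N nN]].
  by exists 0 => n _; split.
exists N => n Nn; split; last exact: down.
move=> In; case: nN; rewrite -(subnKC Nn) in In.
by elim: (n - N) In => [|k IHk]; rewrite ?addn0 // addnS => /down.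
Qed.

(* Disjoint copies of one finite graph with at most [M] vertices: [r x] names the copy
   containing [x] and [pos x] is the vertex of the graph that [x] is a copy of. *)
Lemma copies_coded_presentation (X : Type) (P : X -> Prop) (eta : X -> X -> Prop)
    (r pos : X -> nat) (M : nat) (A : nat -> Prop) (B : nat -> nat -> Prop) :
  (forall x, P x -> pos x < M) ->
  (forall x y, P x -> P y -> r x = r y -> pos x = pos y -> x = y) ->
  (forall x y, P x -> P y -> eta x y -> r x = r y) ->
  (forall x i, P x -> (A i <-> exists u, [/\ P u, r u = r x & pos u = i])) ->
  (forall x i j, P x -> (B i j <->
     exists u v, [/\ P u /\ P v, r u = r x, r v = r x, pos u = i /\ pos v = j & eta u v])) ->
  coded_presentation P eta.
Proof.
move=> posM inj etar HA HB.
case: (pselect (exists x, P x)) => [[x0 Px0]|P0]; last first.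
  by apply: coded_presentation_empty => x Px; apply: P0; exists x.
have M0 : 0 < M by have := posM _ Px0; lia.
pose S k := `[< exists2 x, P x & r x = k >].
have Sr x : P x -> S (r x) by move=> Px; apply/asboolP; exists x.
pose rk x := rank_in S (r x).
pose I n := exists2 x, P x & rk x = n.
have [N HN] : exists N, forall n, N <= n -> (I n <-> I n.+1).
  apply: downward_eventually_constant => n [x Px /rank_in_pred[k /asboolP[y Py <-] e]].
  by exists y.
(* Copy number and position are the quotient and the remainder of the code modulo [M]. *)
pose c x := pos x + M * rk x.
have cdiv x : P x -> c x %/ M = rk x.
  by move=> Px; rewrite /c mulnC addnC divnMDl // divn_small ?addn0 ?posM.
have cmod x : P x -> c x %% M = pos x.
  by move=> Px; rewrite /c mulnC addnC modnMDl modn_small ?posM.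
have c_eq n x : rk x = n %/ M -> pos x = n %% M -> c x = n.
  by move=> e1 e2; rewrite /c e1 e2 addnC mulnC -divn_eq.
have rk_inj x y : P x -> P y -> rk x = rk y -> r x = r y.
  by move=> Px Py; apply: rank_in_inj; apply: Sr.
have CE m : codes P c m <-> I (m %/ M) /\ A (m %% M).
  split=> [[x Px <-]|[[x Px e] /(HA x _ Px)[u [Pu ru pu]]]].
    split; first by exists x; rewrite ?cdiv.
    by apply/(HA x _ Px); exists x; rewrite cmod.
  by exists u => //; apply: c_eq => //; rewrite /rk ru.
have RE m n : coded_rel P c eta m n <->
    I (m %/ M) /\ m %/ M = n %/ M /\ B (m %% M) (n %% M).
  split=> [[x [y [Px Py <- <- xy]]]|].
    have rxy := etar _ _ Px Py xy; rewrite !cdiv // !cmod // /rk rxy.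
    split; first by exists y.
    by split=> //; apply/(HB x _ _ Px); exists x, y; rewrite rxy.
  case=> [[x Px e] [mn /(HB x _ _ Px)[u [v [[Pu Pv] ru rv [pu pv] uv]]]]].
  by exists u, v; split=> //; apply: c_eq => //; rewrite /rk ?ru ?rv -?mn.
have divS m : (m + M) %/ M = (m %/ M).+1 by rewrite divnDr // divnn M0 addn1.
have le_div m n : m + M <= n -> m %/ M < n %/ M.
  by move=> h; rewrite -divS; apply: leq_div2r.
have N_div m : M * N.+1 <= m -> N <= m %/ M.
  by move=> h; rewrite leq_divRL // mulnC; apply: leq_trans h; rewrite leq_mul.
have leM : M <= M * N.+1 by rewrite leq_pmulr.
(* Codes from [M * N.+1] on lie in copies numbered at least [N]; codes at least [M] apart lie in
   different copies, between which there are no edges. *)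
exists c, (M * N.+1), M; split=> //.
- move=> x y Px Py e; apply: inj => //; last by rewrite -(cmod x) // e cmod.
  by apply: rk_inj => //; rewrite -(cdiv x) // e cdiv.
- by move=> m Nm; rewrite !CE divS modnDr (HN _ (N_div _ Nm)).
split=> m n; rewrite !RE.
- move=> Nm Nn; rewrite !divS !modnDr (HN _ (N_div _ Nm)).
  by split=> -[? [? ?]]; split=> //; split=> //; lia.
- by move=> mn; split=> -[_ [e _]]; [have := le_div m n | have := le_div m (n + M)]; lia.
- by move=> nm; split=> -[_ [e _]]; [have := le_div n m | have := le_div n (m + M)]; lia.
Qed.

Lemma In_map_mem (X : Type) (T : eqType) (f : X -> T) x s :
  List.In x s -> f x \in map f s.
Proof.
by elim: s => //= y s IHs [->|/IHs]; rewrite inE ?eqxx // => ->; rewrite orbT.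
Qed.

(** A component is named by the least value of the injection [f] on it. *)
Lemma component_names (X : Type) (eta : X -> X -> Prop) : countable_type X ->
  exists r : X -> nat, forall x y, r x = r y <-> connected eta x y.
Proof.
case=> f inj; pose nm x n := exists2 y, connected eta x y & f y = n.
have /choice[r Hr] : forall x, exists n, nm x n /\ forall m, m < n -> ~ nm x m.
  by move=> x; apply: (@ex_least (nm x)); exists (f x), x => //; exact: conn_refl.
exists r => x y; split=> [e|xy].
  have [[u xu fu] _] := Hr x; have [[v yv fv] _] := Hr y.
  have uv : u = v by apply: inj; rewrite fu fv.
  by apply: connected_trans xu _; rewrite uv; apply: connected_sym.
have nmE n : nm x n <-> nm y n.
  split=> -[u h fu]; exists u => //.
    exact: connected_trans (connected_sym xy) h.
  exact: connected_trans xy h.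
have [nx lx] := Hr x; have [ny ly] := Hr y.
by case: (ltngtP (r x) (r y)) => // lt; [case: (ly _ lt) | case: (lx _ lt)]; apply/nmE.
Qed.

(** The function [g] sorts the vertices into finitely many classes closed under edges: finite
    components by the labelled graph they form on positions below [M], and each infinite component
    alone. *)
Lemma components_presentable (X : Type) (eta : X -> X -> Prop) :
  countable_type X -> finitely_many_infinite_components eta ->
  (forall x, infinite_component eta x -> coded_presentation (connected eta x) eta) ->
  finite_components_bounded eta -> coded_presentation (fun _ => True) eta.
Proof.
move=> cX [reps Hreps] Hinf [M HM].
have [r rP] := component_names eta cX; case: cX => f f_inj.
pose fin x := finite_pred (connected eta x).
have finE x y : connected eta x y -> fin x = fin y.
  move=> xy; apply/propext; split; apply: finite_component_connected => //.
  exact: connected_sym.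
(* The list depends on the component name only, so all vertices of a finite component share it. It
   may contain repetitions or foreign vertices. *)
have /choice[s Hs] : forall k, exists s : seq X, forall x, fin x -> r x = k ->
    size s <= M /\ forall y, r y = k -> List.In y s.
  move=> k; case: (pselect (exists2 x, fin x & r x = k)) => [[x fx rx]|nx].
    have [s [sM Hs]] := HM x fx; exists s => _ _ _; split=> // y ry.
    by apply: Hs; apply/rP; rewrite rx.
  by exists [::] => x fx rx; case: nx; exists x.
(* Mapping the list through [f] supplies the decidable equality that [index] needs. *)
pose pos y := index (f y) (map f (s (r y))).
have posM x : fin x -> pos x < M.
  move=> fx; have [sM Hx] := Hs _ x fx erefl.
  by apply: leq_trans sM; rewrite -(size_map f) index_mem In_map_mem //; apply: Hx.
have pos_inj x y : fin x -> r x = r y -> pos x = pos y -> x = y.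
  move=> fx e; have [_ Hx] := Hs _ x fx erefl.
  rewrite /pos -e => /(congr1 (nth 0 (map f (s (r x))))).
  by rewrite !nth_index ?In_map_mem //; [apply: f_inj | apply: Hx | apply: Hx].
pose occurs k i := exists u, r u = k /\ pos u = i.
pose edge k i j := exists u v, [/\ r u = k, r v = k, pos u = i /\ pos v = j & eta u v].
(* The occupied positions are recorded as well, since some positions below [M] may stay empty. *)
pose shape k : {set 'I_M} * {set 'I_M * 'I_M} :=
  ([set i : 'I_M | `[< occurs k i >]], [set ij : 'I_M * 'I_M | `[< edge k ij.1 ij.2 >]]).
have shapeP k l x y : fin x -> r x = k -> fin y -> r y = l -> shape k = shape l ->
    (forall i, occurs k i -> occurs l i) /\ (forall i j, edge k i j -> edge l i j).
  move=> fx rx fy ry [e1 e2].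
  have lt u : r u = k -> pos u < M.
    move=> ru; apply: posM; have : connected eta x u by apply/rP; rewrite rx.
    by move/finE <-.
  split=> [i [u [ru pu]]|i j [u [v [ru rv [pu pv] uv]]]].
    have iM : i < M by rewrite -pu lt.
    have : Ordinal iM \in [set i : 'I_M | `[< occurs k i >]].
      by rewrite inE; apply/asboolP; exists u.
    by rewrite e1 inE => /asboolP.
  have iM : i < M by rewrite -pu lt.
  have jM : j < M by rewrite -pv lt.
  have : (Ordinal iM, Ordinal jM) \in [set ij : 'I_M * 'I_M | `[< edge k ij.1 ij.2 >]].
    by rewrite inE; apply/asboolP; exists u, v.
  by rewrite e2 inE => /asboolP.
pose T := ({set 'I_M} * {set 'I_M * 'I_M})%type.
(* Taking the first matching representative is unambiguous even if [reps] lists a component several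
   times. *)
pose cls x := find (fun z => `[< connected eta z x >]) reps.
pose g x : nat := if `[< fin x >] then val (enum_rank (shape (r x))) else #|{: T}| + cls x.
have gfin x : fin x -> g x = enum_rank (shape (r x)) by move=> fx; rewrite /g asboolT.
have ginf x : ~ fin x -> g x = #|{: T}| + cls x by move=> fx; rewrite /g asboolF.
have has_cls x : ~ fin x -> has (fun z => `[< connected eta z x >]) reps.
  move=> /Hreps[z zr zx]; elim: (reps) zr => //= y t IHt [->|/IHt ->]; last by rewrite orbT.
  by rewrite asboolT.
apply: (@coded_presentation_fibers _ _ g (#|{: T}| + size reps)).
- move=> x; case: (pselect (fin x)) => fx.
    by rewrite gfin //; apply: leq_trans (ltn_ord _) (leq_addr _ _).
  by rewrite ginf // ltn_add2l -has_find has_cls.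
- move=> x y xy; have cxy : connected eta x y by apply: connected_und; left.
  rewrite /g (finE _ _ cxy) (rP x y).2 //; case: ifP => // _; congr (_ + _).
  apply: eq_find => z; apply/asboolP/asboolP => h; apply: connected_trans h _ => //.
  exact: connected_sym.
move=> k _; case: (pselect (exists x, g x = k)) => [[x0 gx0]|nk]; last first.
  by apply: coded_presentation_empty => x gx; apply: nk; exists x.
case: (pselect (fin x0)) => fx0.
  have fiber x : g x = k <-> fin x /\ shape (r x) = shape (r x0).
    rewrite -gx0 (gfin x0) //; split=> [|[fx e]]; last by rewrite gfin // e.
    case: (pselect (fin x)) => fx; last first.
      by rewrite ginf // => e; have := ltn_ord (enum_rank (shape (r x0))); rewrite -e ltnNge leq_addr.
    by rewrite gfin // => /val_inj/enum_rank_inj.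
  have fibr x y : g x = k -> r y = r x -> g y = k.
    move=> /fiber[fx e] ryx; apply/fiber; rewrite ryx; split=> //.
    by have /rP/finE <- := esym ryx.
  (* The component of [x0] serves as the template of its class. *)
  apply: (@copies_coded_presentation _ _ _ r pos M (occurs (r x0)) (edge (r x0))).
  - by move=> x /fiber[fx _]; apply: posM.
  - by move=> x y /fiber[fx _] _; apply: pos_inj.
  - by move=> x y _ _ xy; apply/rP/connected_und; left.
  - move=> x i gx; have /fiber[fx e] := gx.
    have [H1 _] := shapeP _ _ _ _ fx erefl fx0 erefl e.
    have [H2 _] := shapeP _ _ _ _ fx0 erefl fx erefl (esym e).
    split=> [/H2[u [ru pu]]|[u [_ ru pu]]]; last by apply: H1; exists u.
    by exists u; split=> //; apply: fibr ru.
  - move=> x i j gx; have /fiber[fx e] := gx.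
    have [_ H1] := shapeP _ _ _ _ fx erefl fx0 erefl e.
    have [_ H2] := shapeP _ _ _ _ fx0 erefl fx erefl (esym e).
    split=> [/H2[u [v [ru rv puv uv]]]|[u [v [_ ru rv puv uv]]]]; last by apply: H1; exists u, v.
    by exists u, v; split=> //; split; [apply: fibr ru | apply: fibr rv].
(* Equal values of [cls] mean a common representative, so this fibre is exactly the component of
   [x0]. *)
apply: coded_presentation_ext (Hinf x0 fx0) => x; rewrite -gx0 (ginf x0) //.
split=> [x0x|].
  have fx : ~ fin x by rewrite -(finE _ _ x0x).
  rewrite ginf //; congr (_ + _); apply: eq_find => z.
  apply/asboolP/asboolP => h; apply: connected_trans h _ => //.
  exact: connected_sym.
case: (pselect (fin x)) => fx.
  by rewrite gfin // => e; have := ltn_ord (enum_rank (shape (r x))); rewrite e ltnNge leq_addr.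
rewrite ginf // => /addnI e.
have /(nth_find x0)/asboolP h0 := has_cls _ fx0; have /(nth_find x0)/asboolP h := has_cls _ fx.
by apply: connected_trans (connected_sym h0) _; rewrite -/(cls x0) -e.
Qed.

Theorem theorem6p12 (X : Type) (eta : X -> X -> Prop) :
  countable_type X -> directed_forest eta ->
  (unary_FA_presentable eta <->
   ((finitely_many_infinite_components eta /\
     (forall x, infinite_component eta x ->
        unary_FA_presentable (@component_rel X eta x))) /\
    finite_components_bounded eta)).
Proof.
move=> cX forest; split=> [/presentable_coded pres|[[few inf] bounded]].
  split; last exact: presentable_finite_components_bounded.
  split=> [|x _]; first exact: presentable_finitely_many_infinite.
  by apply/presentable_sigP; apply: presentable_component.
apply: coded_presentable; apply: components_presentable => // x infx.
by apply/presentable_sigP; apply: inf.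
Qed.
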